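(* Let $D\subset\mathbb{R}^d$ be a region of finite positive volume and let $\mathbf{p}_1,\dots,\mathbf{p}_n$ be independent points, each uniformly distributed on $D$. Let $R_n$ be the number of non-dominated records of the sequence $(\mathbf{p}_1,\dots,\mathbf{p}_n)$ and, for $1\le i\le n$, let $M_i$ be the number of maxima of $\{\mathbf{p}_1,\dots,\mathbf{p}_i\}$. Then \[ \mathbb{E}(R_n)=\sum_{i=1}^n\frac{\mathbb{E}(M_i)}{i}. \]
   Context: For $\mathbf{p},\mathbf{q}\in\mathbb{R}^d$, $\mathbf{p}$ dominates $\mathbf{q}$, written $\mathbf{q}\prec\mathbf{p}$, if every coordinate of $\mathbf{p}-\mathbf{q}$ is nonnegative and $\mathbf{p}-\mathbf{q}\neq\mathbf{0}$. The maxima of a finite set are its points not dominated by any point of the set. A point $\mathbf{p}_j$ of the sequence $(\mathbf{p}_1,\dots,\mathbf{p}_n)$ is a non-dominated record if it is not dominated by $\mathbf{p}_i$ for any $1\le i<j$ ($\mathbf{p}_1$ is always a record). *)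

(* Defs.v *)
From HB Require Import structures.
From mathcomp Require Import all_boot all_order all_algebra finmap.
From mathcomp Require Import all_classical all_reals all_analysis.
Set Implicit Arguments.
Unset Strict Implicit.
Unset Printing Implicit Defensive.
Import Order.TTheory GRing.Theory Num.Theory.

Local Open Scope classical_set_scope.
Local Open Scope ring_scope.

(* R^d is [d.-tuple R], whose canonical sigma-algebra (generated by the
   coordinates) is the Borel sigma-algebra. *)

Definition dominated (R : realType) (d : nat) (q p : d.-tuple R) : bool :=
  [forall k, 0 <= tnth p k - tnth q k] && [exists k, tnth p k - tnth q k != 0].

Definition maxima (R : realType) (d : nat) (S : {fset d.-tuple R}) :
    {fset d.-tuple R} :=
  [fset p in S | ~~ has (dominated p) S]%fset.

(* The points are numbered from 0: the prefix of length i is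
   (p_0, ..., p_(i-1)). *)
Definition is_record (R : realType) (d n : nat) (p : 'I_n -> d.-tuple R)
    (j : 'I_n) : bool :=
  [forall i : 'I_n, (i < j)%N ==> ~~ dominated (p j) (p i)].

Definition num_records (R : realType) (d n : nat) (p : 'I_n -> d.-tuple R) :
    nat :=
  #|[set j | is_record p j]|.

Definition prefix_set (R : realType) (d n : nat) (p : 'I_n -> d.-tuple R)
    (i : nat) : {fset d.-tuple R} :=
  [fset p j | j : 'I_n & (j < i)%N]%fset.

Definition num_maxima (R : realType) (d n : nat) (p : 'I_n -> d.-tuple R)
    (i : nat) : nat :=
  #|` maxima (prefix_set p i)|.

Definition box (R : realType) (d : nat) (a b : d.-tuple R) : set (d.-tuple R) :=
  [set x | forall k, tnth a k < tnth x k <= tnth b k].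

Definition box_volume (R : realType) (d : nat) (a b : d.-tuple R) : R :=
  \prod_(k < d) Num.max 0 (tnth b k - tnth a k).

(* Lebesgue outer measure on R^d, for d > 0 (no box is empty when d = 0).  Its
   restriction to [volume.-caratheodory] is the Lebesgue measure. *)
Definition volume (R : realType) (d : nat) (A : set (d.-tuple R)) : \bar R :=
  ereal_inf [set v | exists a b : nat -> d.-tuple R,
    A `<=` \bigcup_k box (a k) (b k) /\
    v = (\sum_(0 <= k <oo) (box_volume (a k) (b k))%:E)%E].

Definition uniform_on (R : realType) (d : nat) (dT : measure_display)
    (T : measurableType dT) (P : probability T R) (D : set (d.-tuple R))
    (X : T -> d.-tuple R) : Prop :=
  forall A : set (d.-tuple R), measurable A ->
    P (X @^-1` A) = (volume (A `&` D) / volume D)%E.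

Definition mutually_independent (R : realType) (n : nat)
    (dT dU : measure_display) (T : measurableType dT) (U : measurableType dU)
    (P : probability T R) (X : 'I_n -> T -> U) : Prop :=
  forall (J : {set 'I_n}) (A : 'I_n -> set U), (forall i, measurable (A i)) ->
    P (\bigcap_(i in [set` J]) (X i @^-1` A i)) =
    (\big[*%E/1]_(i in J) P (X i @^-1` A i))%E.

(* Main.v *)
Require Import Defs.
From HB Require Import structures.
From mathcomp Require Import all_boot all_order all_algebra finmap fingroup perm.
From mathcomp Require Import all_classical all_reals all_analysis.
From mathcomp Require Import measurable_realfun.
Set Implicit Arguments.
Unset Strict Implicit.
Unset Printing Implicit Defensive.
Import Order.TTheory GRing.Theory Num.Theory.
Local Open Scope classical_set_scope.
Local Open Scope ring_scope.

(* Whether p_j is undominated by the first i points is, by exchangeability,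
   equally likely for every j < i, and for j = i - 1 it says that p_j is a
   record.  Ties have probability zero since points are Lebesgue null, so M_i
   is almost surely the number of undominated indices below i, whence
   E(M_i) = i P(the i-th point is a record).  Dividing by i and summing gives
   the claim. *)

(** * Measurability of finite Boolean conditions and of dominance *)

Lemma measurable_forallb d (T : measurableType d) (I : finType)
    (f : I -> T -> bool) : (forall i, measurable_fun setT (f i)) ->
  measurable_fun setT (fun x => [forall i, f i x]).
Proof.
move=> mf; rewrite (_ : (fun _ => _) = fun x => \big[andb/true]_i f i x).
  elim: (index_enum I) => [|i s IH]; first by under eq_fun do rewrite big_nil; exact: measurable_cst.
  by under eq_fun do rewrite big_cons; exact: measurable_and.
by apply/funext => x; rewrite big_andE.
Qed.

Lemma measurable_existsb d (T : measurableType d) (I : finType)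
    (f : I -> T -> bool) : (forall i, measurable_fun setT (f i)) ->
  measurable_fun setT (fun x => [exists i, f i x]).
Proof.
move=> mf; under eq_fun do rewrite -[[exists _, _]]negbK negb_exists.
by apply/measurable_neg/measurable_forallb => i; exact: measurable_neg.
Qed.

Lemma measurable_implyb d (T : measurableType d) (b : bool) (f : T -> bool) :
  measurable_fun setT f -> measurable_fun setT (fun x => b ==> f x).
Proof. by case: b. Qed.

Lemma measurable_boolset d (T : measurableType d) (f : T -> bool) :
  measurable_fun setT f -> measurable [set x | f x].
Proof.
move=> mf; rewrite -[X in measurable X]setTI.
exact: (mf measurableT [set true]).
Qed.

Section tuple_measurability.
Context {R : realType} {n : nat} {d : measure_display} {T : measurableType d}.
Variables f g : T -> n.-tuple R.
Hypotheses (mf : measurable_fun setT f) (mg : measurable_fun setT g).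

Lemma measurable_dominated : measurable_fun setT (fun x => dominated (f x) (g x)).
Proof.
have mB k : measurable_fun setT (fun x => tnth (g x) k - tnth (f x) k).
  by apply: measurable_funB; [move/measurable_fun_tnthP : mg
                            | move/measurable_fun_tnthP : mf]; exact.
apply: measurable_and.
  by apply: measurable_forallb => k; exact: measurable_fun_ler.
by apply: measurable_existsb => k; apply/measurable_neg/measurable_fun_eqr.
Qed.

Lemma measurable_eq_tuple : measurable_fun setT (fun x => f x == g x).
Proof.
rewrite (_ : (fun _ => _) = fun x => [forall k, tnth (f x) k == tnth (g x) k]).
  apply: measurable_forallb => k; apply: measurable_fun_eqr.
    exact: (measurable_fun_tnthP f).1.
  exact: (measurable_fun_tnthP g).1.
apply/funext => x; apply/eqP/forallP => [->//|fg].
by apply: eq_from_tnth => k; exact/eqP.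
Qed.

End tuple_measurability.

(** Linearity of expectation: the cardinal is a sum of indicators, and each indicator integrates to
    a probability. *)
Lemma expectation_card d (T : measurableType d) (R : realType)
    (P : probability T R) (I : finType) (b : I -> T -> bool) :
  (forall i, measurable_fun setT (b i)) ->
  ('E_P[fun w => #|[pred i | b i w]|%:R] = \sum_i P [set w | b i w])%E.
Proof.
move=> mb; have mS i : measurable [set w | b i w] by exact: measurable_boolset.
rewrite unlock.
under eq_integral => w _.
  rewrite (_ : _%:E = \sum_i (\1_[set w | b i w] w)%:E)%E; last first.
    rewrite sumEFin; congr _%:E; rewrite -sum1_card natr_sum big_mkcond/=.
    apply: eq_bigr => i _; rewrite inE indicE.
    by case: (boolP (b i w)) => [bw|/negP bw]; [rewrite mem_set | rewrite memNset].
  over.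
rewrite ge0_integral_sum//=.
- by apply: eq_bigr => i _; rewrite integral_indic// setIT.
- by move=> i; apply/measurable_EFinP; exact: measurable_indic.
Qed.

(** * Exchangeability of independent, identically distributed variables *)

Definition rectangle d (U : measurableType d) n (A : 'I_n -> set U) :
    set (n.-tuple U) :=
  [set t | forall i, A i (tnth t i)].

(** A coordinate cylinder is a rectangle whose other sides are [setT], and a rectangle is a finite
    intersection of cylinders. Rectangles, unlike cylinders, are closed under intersection, as
    uniqueness of measures requires. *)
Lemma measurable_rectangles d (U : measurableType d) n :
  @measurable _ (n.-tuple U) =
  <<s [set rectangle A | A in [set A : 'I_n -> set U | forall i, measurable (A i)]] >>.
Proof.
apply/seteqP; split.
  apply: smallest_sub; first exact: smallest_sigma_algebra.
  move=> B /=; rewrite -bigcup_seq => -[i _ [A mA <-]].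
  apply: sub_gen_smallest; exists (fun j => if j == i then A else setT).
    by move=> j/=; case: ifP.
  apply/seteqP; split=> [t /(_ i)|t [_ ti] j]; first by rewrite eqxx.
  by case: ifP => // /eqP ->.
apply: smallest_sub; first exact: sigma_algebra_measurable.
move=> _ [A mA <-].
rewrite (_ : rectangle A = \bigcap_(i in setT) ((@tnth n U)^~ i @^-1` A i)); last first.
  by apply/seteqP; split=> [t At i _|t At i]; exact: At.
apply: fin_bigcap_measurable => // i _.
by rewrite -[X in measurable X]setTI; exact: measurable_tnth.
Qed.

Section exchangeable.
Context {R : realType} {n : nat} {dT dU : measure_display}.
Context {T : measurableType dT} {U : measurableType dU}.
Variables (P : probability T R) (X : 'I_n -> {RV P >-> U}).
Hypothesis X_indep : mutually_independent P (fun i => X i : T -> U).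

Lemma probability_rectangle (A : 'I_n -> set U) : (forall i, measurable (A i)) ->
  P [set w | forall i, A i (X i w)] = (\prod_(i < n) P (X i @^-1` A i))%E.
Proof.
move=> mA; have := X_indep (finset xpredT) mA.
rewrite (eq_bigl xpredT) => [<-|i]; last by rewrite inE.
by congr (P _); apply/seteqP; split=> [w Aw i _|w Aw i]; apply: Aw; rewrite /= inE.
Qed.

Hypothesis X_ident : forall i j A, measurable A -> P (X i @^-1` A) = P (X j @^-1` A).

(** Permuting the variables only reorders the product of marginals that independence gives on
    rectangles. Two laws that agree on this generating pi-system are equal. *)
Lemma exchangeable (s : {perm 'I_n}) (A : set (n.-tuple U)) : measurable A ->
  P [set w | A [tuple X (s i) w | i < n]] = P [set w | A [tuple X i w | i < n]].
Proof.
have mX (t : {perm 'I_n}) : measurable_fun setT (fun w => [tuple X (t i) w | i < n]).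
  apply/measurable_fun_tnthP => i; rewrite (_ : _ \o _ = X (t i))//.
  by apply/funext => w /=; rewrite tnth_mktuple.
pose Y t : {RV P >-> n.-tuple U} := mfun_Sub (mem_set (mX t)).
have YE B t : distribution P (Y t) B = P [set w | B [tuple X (t i) w | i < n]] by [].
(* The unpermuted tuple is the case of the identity permutation, so one formula on rectangles serves
   both laws. *)
move=> mA; rewrite -YE (_ : P _ = distribution P (Y 1%g) A); last first.
  rewrite YE; congr (P _); apply/seteqP; split=> w /=;
  by rewrite (@eq_mktuple _ _ (fun i => X i w) (fun i => X (perm_one _ i) w))// => i; rewrite perm1.
have rect t B : (forall i, measurable (B i)) ->
    distribution P (Y t) (rectangle B) = (\prod_(i < n) P (X i @^-1` B i))%E.
  (* Coordinate [k] of the permuted tuple is [X (t k)], so [X i] is constrained by the side of index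
     [t^-1 i]. *)
  move=> mB; rewrite YE (_ : [set w | _] = [set w | forall i, B (t^-1 i)%g (X i w)]).
    rewrite (probability_rectangle (A := fun i => B (t^-1 i)%g))// (reindex_inj (@perm_inj _ t))/=.
    by apply: eq_bigr => i _; rewrite permK; exact: X_ident.
  apply/seteqP; split=> w Bw i.
    by have := Bw (t^-1 i)%g; rewrite tnth_mktuple permKV.
  by rewrite tnth_mktuple -[i in B i](permK t).
apply: (measure_unique _ (fun=> setT) (@measurable_rectangles _ U n)) => //.
- move=> _ _ [B mB <-] [C mC <-]; exists (fun i => B i `&` C i).
    by move=> i; exact: measurableI.
  apply/seteqP; split=> [t BCt|t [Bt Ct] i]; last by split.
  by split=> i; have [] := BCt i.
- by move=> _; exists (fun=> setT) => //; apply/seteqP; split.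
- by rewrite bigcup_const//; exists 0%N.
- by move=> _ [B mB <-]; exact: (etrans (rect _ _ mB) (esym (rect _ _ mB))).
- by move=> _; rewrite (le_lt_trans (probability_le1 _ _))// ltry.
Qed.

End exchangeable.

(** * Points are Lebesgue null *)

Section atoms.
Context {R : realType} {d : nat}.
Hypothesis d_gt0 : (0 < d)%N.

Lemma box_volume_ge0 (a b : d.-tuple R) : 0 <= box_volume a b.
Proof. by apply: prodr_ge0 => i _; rewrite le_max lexx. Qed.

Lemma box_volume_empty (a : d.-tuple R) : box_volume a a = 0.
Proof. by rewrite /box_volume (bigD1 (Ordinal d_gt0))//= subrr maxxx mul0r. Qed.

Lemma volume_ge0 (A : set (d.-tuple R)) : (0 <= volume A)%E.
Proof.
apply: le_ereal_inf_tmp => _ [a [b [_ ->]]]; apply: nneseries_ge0 => k _ _.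
by rewrite lee_fin box_volume_ge0.
Qed.

(** The half-open cube of side [r] with upper corner [c] contains [c], and its volume [r ^+ d] is
    arbitrarily small. *)
Lemma volume_point (c : d.-tuple R) (A : set (d.-tuple R)) :
  A `<=` [set c] -> volume A = 0%E.
Proof.
move=> Ac; apply/eqP; rewrite eq_le volume_ge0 andbT.
apply/lee_addgt0Pr => e e0; rewrite add0e.
(* The bound [r <= 1] gives [r ^+ d <= r] for positive [d], and [r <= e] concludes. *)
pose r := Num.min e 1; have r0 : 0 < r by rewrite lt_min e0 ltr01.
pose b := [tuple tnth c k - r | k < d].
apply: (@le_trans _ _ (box_volume b c)%:E).
  apply: ereal_inf_lbound.
  (* A cover is an infinite sequence of boxes: after the first one come empty boxes from [c] to [c],
     of volume zero. *)
  exists (fun k => if k == 0%N then b else c), (fun=> c); split.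
    move=> x /Ac ->; exists 0%N => // k /=.
    by rewrite tnth_mktuple lexx andbT ltrBlDr ltrDl.
  rewrite (nneseries_split 0 1); last by move=> k _; rewrite lee_fin box_volume_ge0.
  rewrite add0n big_nat1 eqxx eseries0 ?adde0// => k k1 _.
  by rewrite gtn_eqF// box_volume_empty.
have -> : box_volume b c = r ^+ d.
  rewrite /box_volume -[in RHS](card_ord d) -prodr_const; apply: eq_bigr => k _.
  by rewrite tnth_mktuple opprB addrC subrK max_r// ltW.
rewrite lee_fin; have /le_trans-> // : r ^+ d <= r ^+ 1.
  by apply: ler_wiXn2l; rewrite // ?(ltW r0)// ge_min lexx orbT.
by rewrite expr1 ge_min lexx.
Qed.

End atoms.

(** * Ties between two independent variables *)

Section pairs.
Context {R : realType} {n : nat} {dT dU : measure_display}.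
Context {T : measurableType dT} {U : measurableType dU}.
Variables (P : probability T R) (X : 'I_n -> {RV P >-> U}).
Hypothesis X_indep : mutually_independent P (fun i => X i : T -> U).

Lemma probability_pair (i j : 'I_n) (A B : set U) : i != j ->
    measurable A -> measurable B ->
  P (X i @^-1` A `&` X j @^-1` B) = (P (X i @^-1` A) * P (X j @^-1` B))%E.
Proof.
move=> ij mA mB; pose C k := if k == i then A else B.
have mC k : measurable (C k) by rewrite /C; case: ifP.
have := X_indep [set i; j]%SET mC.
have ji : (j == i) = false by rewrite eq_sym (negbTE ij).
rewrite big_setU1/= ?inE// big_set1 /C eqxx ji => <-.
congr (P _); apply/seteqP; split=> [w [Aw Bw] k/=|w Cw].
  by rewrite !inE => /orP[]/eqP ->; rewrite ?eqxx ?ji.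
by split; [have := Cw i|have := Cw j]; rewrite /= !inE eqxx ?orbT ?ji; exact.
Qed.

Hypothesis mdiag : measurable [set z : U * U | z.1 = z.2].

(** Independence makes the joint law the product of the two marginals, and the section of the
    diagonal at [x] is the null set [[set x]]. Measurability of the diagonal is assumed because it
    can fail for a general [U]. *)
Lemma probability_tie (i j : 'I_n) : i != j ->
    (forall c, P (X j @^-1` [set c]) = 0%E) ->
  P [set w | X i w = X j w] = 0%E.
Proof.
move=> ij Xj0.
have mXY : measurable_fun setT (fun w => (X i w, X j w)) by exact/measurable_fun_pair.
pose Z : {RV P >-> (U * U)%type} := mfun_Sub (mem_set mXY).
rewrite (_ : P _ = distribution P Z [set z | z.1 = z.2])//.
rewrite -(product_measure_unique (m1 := distribution P (X i)) (m2 := distribution P (X j)))//; last first.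
  by move=> A B mA mB; exact: probability_pair.
(* The product measure is the integral of the measures of the sections. *)
apply: integral0_eq => x _ /=.
rewrite (_ : xsection _ _ = [set x]); first exact: Xj0.
by apply/seteqP; split=> y; rewrite /xsection/= inE/= => ->.
Qed.

End pairs.

(** * Records and maxima as counts of indices *)

Section counting.
Context {R : realType} {d n : nat}.
Implicit Type p : 'I_n -> d.-tuple R.

(** Keeping the prefix length [i] apart from the index [j] covers both notions: [i = j] gives
    records, [j < i] gives maxima of the prefix. *)
Definition undominated p (i : nat) (j : 'I_n) : bool :=
  [forall k : 'I_n, (k < i)%N ==> ~~ dominated (p j) (p k)].

Definition first_occurrence p (j : 'I_n) : bool :=
  [forall k : 'I_n, (k < j)%N ==> (p k != p j)].

Lemma num_recordsE p : num_records p = #|[pred j : 'I_n | undominated p j j]|.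
Proof. by apply: eq_card => j; apply/idP/idP => [/set_mem|/mem_set]. Qed.

(* The maxima form a set, so that a repeated point counts once. *)
Lemma num_maximaE p i : num_maxima p i =
  #|[pred j : 'I_n | [&& (j < i)%N, undominated p i j & first_occurrence p j]]|.
Proof.
set S := [pred _ | _].
have p_inj : {in S &, injective p}.
  have lt_neq (j k : 'I_n) : k \in S -> (j < k)%N -> p j = p k -> False.
    by rewrite !inE => /and3P[_ _ /forallP/(_ j)/implyP fk] /fk/eqP.
  move=> j k jS kS jk; apply/val_inj/eqP => /=.
  by case: ltngtP => // [/(lt_neq _ _ kS)/(_ jk)|/(lt_neq _ _ jS)/(_ (esym jk))].
(* It remains to see that [p] maps the counted indices onto the maxima. *)
rewrite /num_maxima [RHS]cardE -(size_map p); apply/perm_size/uniq_perm.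
- exact: fset_uniq.
- by rewrite map_inj_in_uniq ?enum_uniq// => j k; rewrite !mem_enum; exact: p_inj.
move=> x; apply/idP/mapP.
  rewrite !inE => /andP[/imfsetP[/= j0 j0i ->{x}] undom].
  (* The least index carrying the value is a first occurrence, and it stays below [i] because [j0]
     does. *)
  have /ex_minnP[m /existsP[j /andP[/eqP jm /eqP pj]] min] :
      exists m, [exists j : 'I_n, (val j == m) && (p j == p j0)].
    by exists (val j0); apply/existsP; exists j0; rewrite !eqxx.
  exists j => //; rewrite mem_enum !inE; apply/and3P; split.
  + rewrite jm; apply: leq_ltn_trans j0i; apply: min.
    by apply/existsP; exists j0; rewrite !eqxx.
  + apply/forallP => k; apply/implyP => ki; rewrite pj.
    apply: contra undom => dom; apply/hasP; exists (p k) => //.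
    by apply/imfsetP; exists k.
  + apply/forallP => k; apply/implyP => kj; apply: contraL kj => /eqP pk.
    by rewrite -leqNgt jm min//; apply/existsP; exists k; rewrite eqxx pk pj eqxx.
move=> [j]; rewrite mem_enum !inE => /and3P[ji undom _] ->.
apply/andP; split; first by apply/imfsetP; exists j.
apply/hasPn => _ /imfsetP[/= k ki ->].
by move/forallP : undom => /(_ k)/implyP; exact.
Qed.

(** The only additional index is [j] itself, and no point dominates itself. *)
Lemma undominated_record p (j : 'I_n) :
  undominated p j.+1 j = undominated p j j.
Proof.
apply/forallP/forallP => undom k; apply/implyP => kj; have := undom k.
  by rewrite ltnS ltnW.
move: kj; rewrite ltnS leq_eqVlt => /predU1P[/val_inj ->|->//] _.
rewrite negb_and; apply/orP; right.
by apply/existsPn => l; rewrite subrr eqxx.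
Qed.

End counting.

(** * The expected number of maxima of a prefix *)

Section expected_maxima.
Context {R : realType} {d n : nat} {dT : measure_display}.
Context {T : measurableType dT}.
Variables (P : probability T R) (X : 'I_n -> {RV P >-> d.-tuple R}).

(** The space [S] is arbitrary because the lemma serves both on [T] and on the space of tuples of
    points. *)
Lemma measurable_undominated dS (S : measurableType dS)
    (Y : 'I_n -> S -> d.-tuple R) i j :
  (forall k, measurable_fun setT (Y k)) ->
  measurable_fun setT (fun w => undominated (Y ^~ w) i j).
Proof.
move=> mY; apply: measurable_forallb => k; apply: measurable_implyb.
exact/measurable_neg/measurable_dominated.
Qed.

Lemma measurable_first_occurrence j :
  measurable_fun setT (fun w => first_occurrence (fun k => X k w) j).
Proof.
apply: measurable_forallb => k; apply: measurable_implyb.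
exact/measurable_neg/measurable_eq_tuple.
Qed.

Hypothesis X_indep : mutually_independent P (fun i => X i : T -> d.-tuple R).
Hypothesis X_ident : forall i j A, measurable A -> P (X i @^-1` A) = P (X j @^-1` A).

(** The transposition of [j] and [i] preserves the prefix of length [i.+1] and moves [j] to its last
    place, so exchangeability applies. *)
Lemma probability_undominated (i j : 'I_n) : (j <= i)%N ->
  P [set w | undominated (fun k => X k w) i.+1 j] =
  P [set w | undominated (fun k => X k w) i i].
Proof.
move=> ji; pose A := [set t : n.-tuple (d.-tuple R) | undominated (tnth t) i.+1 i].
have mA : measurable A.
  apply: measurable_boolset; apply: measurable_undominated => k.
  exact: measurable_tnth.
have lt_tperm k : (tperm j i k < i.+1)%N = (k < i.+1)%N.
  by case: tpermP => [->|->|//]; rewrite !ltnS leqnn ji.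
have tnthE (s : {perm 'I_n}) w : tnth [tuple X (s k) w | k < n] = (fun k => X (s k) w).
  by apply/funext => k; rewrite tnth_mktuple.
transitivity (P [set w | A [tuple X (tperm j i k) w | k < n]]).
  congr (P _); apply/seteqP; split=> w; rewrite /A/= tnthE => /forallP undom.
    by apply/forallP => k; rewrite tpermR -lt_tperm; exact: undom.
  apply/forallP => k; have := undom (tperm j i k).
  by rewrite tpermR tpermK lt_tperm.
rewrite (exchangeable X_indep X_ident)//; congr (P _).
apply/funext => w; rewrite /A/= -undominated_record.
by congr (is_true (undominated _ _ _)); apply/funext => k; rewrite tnth_mktuple.
Qed.

Hypothesis X_atomless : forall i c, P (X i @^-1` [set c]) = 0%E.

(** The event is a finite union of ties with earlier points, each of probability zero. *)
Lemma probability_not_first (j : 'I_n) :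
  P [set w | ~~ first_occurrence (fun k => X k w) j] = 0%E.
Proof.
have mdiag : measurable [set z : d.-tuple R * d.-tuple R | z.1 = z.2].
  rewrite (_ : mkset _ = [set z | z.1 == z.2]); last first.
    by apply/seteqP; split=> z /= /eqP.
  exact/measurable_boolset/measurable_eq_tuple.
have mB (k : 'I_n) : measurable [set w | X k w = X j w].
  rewrite (_ : mkset _ = [set w | X k w == X j w]); last first.
    by apply/seteqP; split=> w /= /eqP.
  exact/measurable_boolset/measurable_eq_tuple.
rewrite (_ : mkset _ = \big[setU/set0]_(k < n | (k < j)%N) [set w | X k w = X j w]).
  (* Measurability is part of the invariant so that nullity passes to unions. *)
  apply: (big_ind (fun B => measurable B /\ P B = 0%E) _ _ _).2 => //.
    by move=> B C [mB' B0] [mC C0]; split; [exact: measurableU|exact: null_set_setU].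
  by move=> k kj; split=> //; apply: probability_tie => //; rewrite -val_eqE/= ltn_eqF.
rewrite -bigcup_seq_cond; apply/seteqP; split=> w /=.
  move=> /forallPn[k]; rewrite negb_imply negbK => /andP[kj /eqP Xkj].
  by exists k => //=; rewrite mem_index_enum.
move=> [k /= /andP[_ kj] Xkj]; apply/forallPn; exists k.
by rewrite kj Xkj eqxx.
Qed.

Lemma expectation_num_maxima (i : 'I_n) :
  ('E_P[fun w => (num_maxima (fun k => X k w) i.+1)%:R] =
   i.+1%:R%:E * P [set w | undominated (fun k => X k w) i i])%E.
Proof.
under [X in expectation _ X]funext => w do rewrite num_maximaE.
have mU j : measurable_fun setT (fun w => undominated (fun k => X k w) i.+1 j).
  exact: measurable_undominated.
rewrite expectation_card; last first.
  move=> j; apply: measurable_and => //; apply: measurable_and => //.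
  exact: measurable_first_occurrence.
(* Indices outside the prefix contribute zero; the [i.+1] others contribute equally. *)
transitivity (\sum_(j < n | (j < i.+1)%N) P [set w | undominated (fun k => X k w) i i])%E.
  rewrite [RHS]big_mkcond/=; apply: eq_bigr => j _; case: ltnP => [ji|_]/=; last first.
    by rewrite (_ : mkset _ = set0) ?measure0//; apply/seteqP; split.
  rewrite -(probability_undominated ji).
  set N := [set w | ~~ first_occurrence (fun k => X k w) j].
  have mF := measurable_first_occurrence j.
  have mN : measurable N by exact/measurable_boolset/measurable_neg.
  have N0 : P N = 0%E by exact: probability_not_first.
  (* Adjoining the null event [N] to both sides makes the two events equal. *)
  rewrite -(measureU0 _ mN N0); last first.
    by apply: measurable_boolset; exact: measurable_and.
  rewrite -[RHS](measureU0 _ mN N0); last exact: measurable_boolset.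
  congr (P _); apply/seteqP; split=> w /=.
    by move=> [/andP[]|]; [left|right].
  move=> [Uj|]; last by right.
  by rewrite /N/= Uj; case: first_occurrence; [left|right].
by rewrite (big_ord_narrow (ltn_ord i)) sumr_const card_ord mule_natl.
Qed.

End expected_maxima.

Theorem theorem1 (R : realType) (d : nat) (d_gt0 : (0 < d)%N)
  (D : set (d.-tuple R))
  (D_meas : (@volume R d).-caratheodory D)
  (D_pos : (0 < volume D)%E) (D_fin : (volume D < +oo)%E)
  (dT : measure_display) (T : measurableType dT) (P : probability T R)
  (n : nat) (X : 'I_n -> {RV P >-> d.-tuple R})
  (X_unif : forall i, uniform_on P D (X i))
  (X_indep : mutually_independent P (fun i => X i : T -> d.-tuple R)) :
  ('E_P[fun w => (num_records (fun j => X j w))%:R] =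
   \sum_(1 <= i < n.+1)
     'E_P[fun w => (num_maxima (fun j => X j w) i)%:R] / i%:R%:E)%E.
Proof.
have X_ident i j A : measurable A -> P (X i @^-1` A) = P (X j @^-1` A).
  by move=> mA; rewrite !(X_unif _ _ mA).
have X_atomless i c : P (X i @^-1` [set c]) = 0%E.
  have mc : measurable [set c].
    rewrite (_ : [set c] = [set x | x == c]).
      exact/measurable_boolset/measurable_eq_tuple.
    by apply/seteqP; split=> x /= /eqP.
  by rewrite X_unif// (volume_point d_gt0 (@subIsetl _ _ _)) mul0e.
under [X in expectation _ X]funext => w do rewrite num_recordsE.
rewrite expectation_card; last by move=> j; exact: measurable_undominated.
(* After the shift, the record at index [i], counted from 0, faces the prefix of length [i.+1]. *)
rewrite big_add1/= big_mkord; apply: eq_bigr => i _.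
rewrite (expectation_num_maxima X_indep X_ident X_atomless).
(* Since [i.+1] is nonzero, the extended inverse is the real one and the factor cancels. *)
rewrite inver pnatr_eq0/= muleAC -EFinM divff ?mul1e//.
Qed.
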